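(* Let $e \ge 5$ be an integer such that $t_e \ge 1$, and let $\ell_e = \dfrac{e k_e}{e - k_e - 1}$. Then for any integer $$n > e + 2 + \frac{\ell_e(\ell_e+1)(\ell_e^2-\ell_e-2e)}{\ell_e^2-e},$$ the graph $\mathcal{V}_{n,e}$ is the unique graph (up to isomorphism) that attains the maximum spectral radius on $\mathcal{C}_{n,e}$.
   Context: All graphs are undirected, finite and simple. The spectral radius of a graph is the largest modulus of an eigenvalue of its adjacency matrix. $G_1 \lor G_2$ and $G_1 + G_2$ denote the join and the disjoint union of graphs; $0K_1$ is the empty graph on no vertices, neutral for both operations. $\mathcal{C}_{n,e}$ is the set of connected graphs with $n$ vertices and $n-1+e$ edges. For $n \ge e+2$, the graph $\mathcal{V}_{n,e} \in \mathcal{C}_{n,e}$ is $\mathcal{V}_{n,e} = (K_{1,e} + (n-e-2)K_1) \lor K_1$. For an integer $e \ge 1$, $k_e$ is the largest natural number with $\binom{k_e}{2} \le e$, and $t_e = e - \binom{k_e}{2}$ (so $0 \le t_e \le k_e - 1$). *)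

(* Defs.v *)
From HB Require Import structures.
From mathcomp Require Import all_boot all_order all_algebra.
From mathcomp Require Import reals complex.

Set Implicit Arguments.
Unset Strict Implicit.
Unset Printing Implicit Defensive.

Import Order.TTheory GRing.Theory Num.Theory.
Local Open Scope ring_scope.

Record sgraph := SGraph {
  vertex :> finType;
  adj : rel vertex;
  adj_sym : symmetric adj;
  adj_irr : irreflexive adj
}.

Definition edges (G : sgraph) : {set {set G}} :=
  [set [set p.1; p.2] | p : G * G & adj p.1 p.2].

Definition connected (G : sgraph) : Prop :=
  (0 < #|G|)%N /\ forall x y : G, connect (@adj G) x y.

Definition isomorphic (G H : sgraph) : Prop :=
  exists f : G -> H, bijective f /\ forall x y, adj (f x) (f y) = adj x y.

(* edgeless m is the graph m K_1; in particular edgeless 1 is K_1. *)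
Lemma edgeless_sym m : symmetric (fun _ _ : 'I_m => false).
Proof. by []. Qed.

Lemma edgeless_irr m : irreflexive (fun _ : 'I_m => fun _ => false).
Proof. by []. Qed.

Definition edgeless (m : nat) : sgraph :=
  SGraph (@edgeless_sym m) (@edgeless_irr m).

Section Operations.
Variables G H : sgraph.

(* The boolean b tells whether the vertices of G are joined to those of H. *)
Definition sum_adj (b : bool) : rel (G + H)%type :=
  fun x y => match x, y with
  | inl u, inl v => adj u v
  | inr u, inr v => adj u v
  | _, _ => b
  end.

Lemma sum_adj_sym b : symmetric (sum_adj b).
Proof. by case=> u [] v //=; apply: adj_sym. Qed.

Lemma sum_adj_irr b : irreflexive (sum_adj b).
Proof. by case=> u /=; apply: adj_irr. Qed.

Definition gsum : sgraph := SGraph (sum_adj_sym false) (sum_adj_irr false).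
Definition gjoin : sgraph := SGraph (sum_adj_sym true) (sum_adj_irr true).
End Operations.

Definition star (e : nat) : sgraph := gjoin (edgeless 1) (edgeless e).

(* V_{n,e} = (K_{1,e} + (n-e-2) K_1) \/ K_1; meaningful for n >= e + 2 only,
   because of the truncated subtraction. *)
Definition graphV (n e : nat) : sgraph :=
  gjoin (gsum (star e) (edgeless (n - e - 2)%N)) (edgeless 1).

Definition classC (n e : nat) (G : sgraph) : Prop :=
  [/\ connected G, #|G| = n & #|edges G| = (n - 1 + e)%N].

Definition adjmx (K : nzRingType) (G : sgraph) : 'M[K]_#|G| :=
  \matrix_(i, j) (adj (enum_val i) (enum_val j))%:R.

(* Complex eigenvalues, with multiplicity. *)
Definition spectrum (R : realType) n (A : 'M[R[i]]_n) : seq R[i] :=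
  sval (closed_field_poly_normal (char_poly A)).

(* complex.Re only casts the modulus, which is a real element of R[i], to R. *)
Definition spectral_radius (R : realType) (G : sgraph) : R :=
  \big[Num.max/0]_(z <- spectrum (adjmx R[i] G)) complex.Re `|z|.

Lemma mem_spectrum (R : realType) n (A : 'M[R[i]]_n) z :
  (z \in spectrum A) = eigenvalue A z.
Proof.
rewrite eigenvalue_root_char /spectrum; case: closed_field_poly_normal => s /= ->.
by rewrite (monicP (char_poly_monic A)) scale1r root_prod_XsubC.
Qed.

Lemma spectral_radius_max (R : realType) (G : sgraph) :
  (0 < #|G|)%N ->
  (exists2 z : R[i], eigenvalue (adjmx _ G) z & `|z| = (spectral_radius R G)%:C%C)
  /\ (forall z : R[i], eigenvalue (adjmx _ G) z ->
        `|z| <= (spectral_radius R G)%:C%C).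
Proof.
move=> G0; have normE (z : R[i]) : `|z| = (complex.Re `|z|)%:C%C.
  by rewrite normc_def.
have Re_ge0 (z : R[i]) : 0 <= complex.Re `|z| by rewrite normc_def /= sqrtr_ge0.
rewrite /spectral_radius; set s := spectrum _; split; last first.
  move=> z; rewrite -mem_spectrum -/s normE lecR => zs.
  exact: (@le_bigmax_seq _ _ _ _ _ z xpredT).
suff [z zs zE] : exists2 z, z \in s &
    complex.Re `|z| = \big[Num.max/0]_(y <- s) complex.Re `|y|.
  by exists z; rewrite -?mem_spectrum // normE zE.
have : s != [::].
  apply/eqP=> s0; have := size_char_poly (adjmx R[i] G).
  have := monicP (char_poly_monic (adjmx R[i] G)).
  move: s0; rewrite /s /spectrum; case: closed_field_poly_normal => r /= rE r0.
  move=> lc; rewrite rE r0 lc big_nil scale1r size_poly1.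
  by case=> G00; rewrite -G00 in G0.
elim: {G0} s => // a s IH _; rewrite big_cons.
have [->|s0] := eqVneq s [::].
  by exists a; rewrite ?mem_head // big_nil max_l.
have [z zs <-] := IH s0.
case: (leP (complex.Re `|a|) (complex.Re `|z|)) => _.
  by exists z; rewrite // inE zs orbT.
by exists a; rewrite // mem_head.
Qed.

Definition max_spectral_radius (R : realType) (n e : nat) (G : sgraph) : Prop :=
  classC n e G /\
  forall H, classC n e H -> spectral_radius R H <= spectral_radius R G.

(* The search bound is harmless: 'C(k, 2) <= e forces k <= e + 1. *)
Definition k_ (e : nat) : nat := \max_(k < e.+2 | ('C(k, 2) <= e)%N) k.

Lemma k_P (e : nat) :
  ('C(k_ e, 2) <= e)%N /\ forall k, ('C(k, 2) <= e)%N -> (k <= k_ e)%N.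
Proof.
split.
  have Agt0 : (0 < #|[pred k : 'I_e.+2 | 'C(k, 2) <= e]|)%N.
    by apply/card_gt0P; exists ord0.
  by have [i Pi ki] := eq_bigmax_cond (@nat_of_ord _) Agt0; rewrite /k_ ki.
move=> k Ck; have ke : (k < e.+2)%N.
  rewrite ltnNge; apply/negP=> ek.
  have : ('C(e.+2, 2) <= e)%N by apply: leq_trans Ck; apply: leq_bin2l.
  by rewrite binS bin1 => /(leq_trans (leq_addl _ _)); rewrite ltnn.
exact: (leq_bigmax_cond (Ordinal ke)).
Qed.

Definition t_ (e : nat) : nat := (e - 'C(k_ e, 2))%N.

Definition ell_ (e : nat) : rat :=
  (e%:R * (k_ e)%:R) / (e%:R - (k_ e)%:R - 1).

(* Main.v *)
Require Import Defs.
From HB Require Import structures.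
From mathcomp Require Import all_boot all_order all_algebra.
From mathcomp Require Import boolp reals complex.
From mathcomp Require Import spectral sesquilinear ring lra zify.

(** Why the theorem holds.

    The graph V is a vertex joined to a star and to isolated vertices, so its
    eigenvector equations can be solved explicitly, and for every mu above the
    square root of e they give mu < rho(V) as soon as

      mu^2 (mu^2 - e) < (n - 2 - e) (mu^2 - e) + mu ((e + 1) mu + 2 e)

    (lt_spectral_radius_V).  The lower bound on n is this inequality at
    mu = ell_e.  The number ell_e is in turn the point where
    l (k + 1) = e (l - k): at that point the vector that is constantly
    1 / (l - k) on K_(k+1), which satisfies the eigenvector equations of a
    clique joined to a vertex of weight 1, takes the value
    (l + e) / (l (l + 1)) which, as explained below, decides the comparison
    with V.

    Let G be a maximizer, l its spectral radius and x its Perron vector.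
    Replacing an edge v w by u w when x u >= x v cannot lower the Rayleigh
    quotient and would in fact increase the radius (maximizer_shift).  Hence G
    has a dominating vertex o, scaled to x o = 1, and off o the neighbourhoods
    are nested in the order of the values of x (maximizer_dominated).  Let
    p1, p2, p3 be the vertices with the three largest values of x off o.

    Suppose that some edge avoids both o and p1.  By nestedness p1 p2 p3 is a
    triangle, and every edge u v avoiding o and p1 has
    x u + x v <= x p1 + x p3.  Summing the eigenvector equations over the
    vertices other than o and p1, and using that V does not have a larger
    radius than G, gives x p3 >= (l + e) / (l (l + 1))
    (center_contradiction).  On the other hand, applying the eigenvector
    equations twice at p1, p2 and p3 gives three linear inequalities between
    the values there, whose coefficients only depend on how the e edges off o
    are distributed around the triangle; they force
    x p3 < (l + e) / (l (l + 1)) for every l > ell_e (psi_gt0, third_bound,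
    third_le).  This contradiction shows that all edges meet o or p1, which
    identifies G with V (two_hubs_iso).

    Finally there are finitely many graphs on n vertices up to isomorphism, so
    a maximizer exists, and being isomorphic to V it makes V a maximizer. *)

Set Implicit Arguments.
Unset Strict Implicit.
Unset Printing Implicit Defensive.

Import Order.TTheory GRing.Theory Num.Theory.
Local Open Scope ring_scope.

(** * The spectral radius as a maximal Rayleigh quotient *)

Section Rayleigh.
Local Open Scope sesquilinear_scope.

(** Makes the spectral theorem for normal matrices applicable. *)
Lemma adjmx_hermitian (R : realType) (G : sgraph) :
  adjmx R[i] G \is hermsymmx.
Proof.
apply: realsym_hermsym.
  by apply/is_hermitianmxP; rewrite expr0 scale1r; apply/matrixP => i j; rewrite !mxE adj_sym.
by apply/mxOverP => i j; rewrite mxE realn.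
Qed.

(** The adjacency matrix acting on functions on the vertices: eigenvector
    equations are stated with it, without enumerating the vertices. *)
Definition nbr_sum (R : realType) (G : sgraph) (x : G -> R) (u : G) : R :=
  \sum_v (adj u v)%:R * x v.

Lemma spectral_radius_ge0 (R : realType) (G : sgraph) :
  0 <= spectral_radius R G.
Proof. by rewrite /spectral_radius; elim/big_ind: _ => // [x y x0 y0|z _]; [rewrite le_max x0|rewrite normc_def /= sqrtr_ge0]. Qed.

(** In an orthonormal eigenbasis the left-hand side becomes the sum of the
    eigenvalues weighted by squared moduli, and each eigenvalue is real and at
    most the spectral radius. *)
Lemma rayleigh (R : realType) (G : sgraph) (x : G -> R) :
  \sum_u x u * nbr_sum x u <= spectral_radius R G * \sum_u x u ^+ 2.
Proof.
have -> : \sum_u x u * nbr_sum x u = \sum_u \sum_v (adj u v)%:R * x u * x v.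
  apply: eq_bigr => u _; rewrite mulr_sumr; apply: eq_bigr => v _.
  by rewrite mulrCA mulrA.
have [G0|Gpos] := posnP #|G|.
  by rewrite !big_pred0 ?mulr0 // => u; have := card0_eq G0 u.
have [_ rho_max] := spectral_radius_max R Gpos.
set A := adjmx R[i] G in rho_max.
have Aherm : A \is hermsymmx by apply: adjmx_hermitian.
have /orthomx_spectralP defA := hermitian_normalmx Aherm.
have Ureal := hermitian_spectral_diag_real Aherm.
have Uunit := spectral_unitarymx A.
set P := spectralmx A in defA Uunit; set D := spectral_diag A in defA Ureal.
rewrite invmx_unitary // in defA.
have D_le i : D 0 i <= (spectral_radius R G)%:C%C.
  have Dr : D 0 i \is Num.real by move/mxOverP: Ureal; apply.
  apply: le_trans (real_ler_norm Dr) (rho_max _ _).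
  apply/eigenvalueP; exists (row i P); last first.
    apply/eqP => /rowP P0; have /unitarymxP/matrixP/(_ i i) := Uunit.
    rewrite !mxE eqxx big1 => [/esym/eqP|j _]; first by rewrite oner_eq0.
    by have := P0 j; rewrite !mxE => ->; rewrite mul0r.
  rewrite -row_mul defA !mulmxA (unitarymxP Uunit) mul1mx.
  by rewrite mul_diag_mx; apply/rowP => j; rewrite !mxE.
pose r : 'rV[R[i]]_#|G| := \row_i (x (enum_val i))%:C%C.
have rE : r ^t* = r^T by apply/matrixP => i j; rewrite !mxE; exact: conjc_real.
pose w := r *m P ^t*.
have wE : w ^t* = P *m r^T by rewrite /w trmx_mul map_mxM trmxCK rE.
have qE : (r *m A *m r^T) 0 0 = \sum_i D 0 i * `|w 0 i| ^+ 2.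
  rewrite defA !mulmxA -/w -mulmxA -wE mul_mx_diag !mxE.
  by apply: eq_bigr => i _; rewrite !mxE normCK mulrAC mulrC mulrA.
have nE : (r *m r^T) 0 0 = \sum_i `|w 0 i| ^+ 2.
  have -> : r *m r^T = w *m w ^t*.
    by rewrite wE /w -!mulmxA [P ^t* *m _]mulmxA -(invmx_unitary Uunit) mulVmx ?unitarymx_unit// mul1mx.
  by rewrite !mxE; apply: eq_bigr => i _; rewrite !mxE normCK.
have : (r *m A *m r^T) 0 0 <= (spectral_radius R G)%:C%C * (r *m r^T) 0 0.
  rewrite qE nE mulr_sumr; apply: ler_sum => i _.
  by rewrite ler_wpM2r ?exprn_ge0.
have -> : (r *m r^T) 0 0 = (\sum_u x u ^+ 2)%:C%C.
  rewrite mxE rmorph_sum (reindex _ (onW_bij _ (@enum_rank_bij _))) /=.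
  by apply: eq_bigr => u _; rewrite !mxE enum_rankK -rmorphM.
have -> : (r *m A *m r^T) 0 0 = (\sum_u \sum_v (adj u v)%:R * x u * x v)%:C%C.
  rewrite mxE rmorph_sum (reindex _ (onW_bij _ (@enum_rank_bij _))) /=.
  rewrite (eq_bigr (fun v => \sum_u ((adj u v)%:R * x u * x v)%:C%C)).
    by rewrite exchange_big; apply: eq_bigr => v _; rewrite rmorph_sum.
  move=> v _; rewrite !mxE mulr_suml (reindex _ (onW_bij _ (@enum_rank_bij _))).
  apply: eq_bigr => u _; rewrite !mxE !enum_rankK !rmorphM /= rmorph_nat.
  by congr (_ * _); rewrite mulrC.
by rewrite -rmorphM lecR.
Qed.

(** Equality in [rayleigh] means that x minimizes the nonnegative quadratic
    form rho |y|^2 - <y, A y>, so all its partial derivatives vanish at x. *)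
Lemma rayleigh_eq (R : realType) (G : sgraph) (x : G -> R) :
  spectral_radius R G * \sum_u x u ^+ 2 <= \sum_u x u * nbr_sum x u ->
  forall u, nbr_sum x u = spectral_radius R G * x u.
Proof.
set rho := spectral_radius R G => x_max u0.
have rho0 : 0 <= rho := spectral_radius_ge0 R G.
pose alpha := rho * x u0 - nbr_sum x u0.
have pert t : 0 <= 2 * t * alpha + t ^+ 2 * rho.
  have := rayleigh (fun u => x u + t * (u == u0)%:R); rewrite -/rho.
  have delta (f : G -> R) : \sum_u f u * (u == u0)%:R = f u0.
    rewrite (bigD1 u0) //= eqxx mulr1 big1 ?addr0 // => u /negPf ->.
    by rewrite mulr0.
  have -> : \sum_u (x u + t * (u == u0)%:R) ^+ 2
      = \sum_u x u ^+ 2 + 2 * t * x u0 + t ^+ 2.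
    rewrite -(delta (fun u => 2 * t * x u)) -(delta (fun u => t ^+ 2)).
    rewrite -!big_split; apply: eq_bigr => u _ /=.
    by case: (u == u0); rewrite /= ?(mulr1, mulr0, addr0); ring.
  have nsE u : nbr_sum (fun v => x v + t * (v == u0)%:R) u
      = nbr_sum x u + t * (adj u u0)%:R.
    rewrite /nbr_sum -(delta (fun v => t * (adj u v)%:R)) -big_split.
    by apply: eq_bigr => v _ /=; ring.
  have -> : \sum_u (x u + t * (u == u0)%:R)
        * nbr_sum (fun v => x v + t * (v == u0)%:R) u
      = \sum_u x u * nbr_sum x u + 2 * t * nbr_sum x u0.
    have -> : 2 * t * nbr_sum x u0 = \sum_u t * (adj u0 u)%:R * x u
        + \sum_u t * (nbr_sum x u + t * (adj u u0)%:R) * (u == u0)%:R.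
      rewrite delta adj_irr mulr0 addr0 {2}/nbr_sum mulr_sumr.
      under [in RHS]eq_bigr do rewrite -mulrA.
      by rewrite -mulr_sumr -/(nbr_sum x u0); ring.
    rewrite -!big_split; apply: eq_bigr => u _ /=.
    by rewrite nsE (adj_sym u0); ring.
  by move=> h; rewrite /alpha; nra.
(* A step against the derivative [2 * alpha]; the denominator is [rho + 1]
   and not [rho] because rho may vanish. *)
have := pert (- alpha / (rho + 1)).
have r1 : rho + 1 != 0 by lra.
have -> : 2 * (- alpha / (rho + 1)) * alpha + (- alpha / (rho + 1)) ^+ 2 * rho
    = - (alpha / (rho + 1)) ^+ 2 * (rho + 2) by field.
have := sqr_ge0 (alpha / (rho + 1)); set z := _ ^+ 2 => z0 h.
have : z == 0 by apply/eqP; nra.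
rewrite sqrf_eq0 mulf_eq0 invr_eq0 (negPf r1) orbF /alpha subr_eq0.
by move/eqP.
Qed.

(** The moduli of an eigenvector for an eigenvalue of largest modulus have
    Rayleigh quotient at least the spectral radius, by the triangle inequality;
    so [rayleigh_eq] applies to them. *)
Lemma perron (R : realType) (G : sgraph) : (0 < #|G|)%N ->
  exists x : G -> R, [/\ forall u, 0 <= x u, exists u, x u != 0
    & forall u, nbr_sum x u = spectral_radius R G * x u].
Proof.
move=> Gpos; have [[z /eigenvalueP[w wA w0] zE] _] := spectral_radius_max R Gpos.
set rho := spectral_radius R G in zE *.
pose x (u : G) : R := complex.Re `|w 0 (enum_rank u)|.
have xE u : (x u)%:C%C = `|w 0 (enum_rank u)| by rewrite /x normc_def.
have x0 u : 0 <= x u by rewrite /x normc_def /= sqrtr_ge0.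
exists x; split=> //.
  have [j wj] : exists j, w 0 j != 0.
    apply/existsP; rewrite -negb_forall; apply: contra w0 => /forallP w0.
    by apply/eqP/rowP => j; rewrite mxE; apply/eqP.
  exists (enum_val j); apply: contra wj => /eqP xj.
  by rewrite -normr_eq0 -{1}(enum_valK j) -xE xj.
apply: rayleigh_eq; rewrite mulr_sumr; apply: ler_sum => u _.
rewrite expr2 mulrCA ler_wpM2l //.
rewrite -lecR rmorphM /= xE -zE -normrM.
have /rowP/(_ (enum_rank u)) := wA; rewrite !mxE => <-.
apply: le_trans (ler_norm_sum _ _ _) _.
rewrite /nbr_sum rmorph_sum (reindex _ (onW_bij _ (@enum_rank_bij _))) /=.
apply: ler_sum => v _; rewrite !mxE !enum_rankK normrM normr_nat -xE.
by rewrite rmorphM /= rmorph_nat mulrC adj_sym.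
Qed.

End Rayleigh.

(** The Collatz-Wielandt bound in strict form.  It bounds the radius of V from
    below without computing any eigenvalue of V. *)
Lemma lt_spectral_radius (R : realType) (G : sgraph) (y : G -> R) (mu : R) :
  (forall u, 0 <= y u) -> (forall u, mu * y u <= nbr_sum y u) ->
  (exists u, 0 < y u /\ mu * y u < nbr_sum y u) -> mu < spectral_radius R G.
Proof.
move=> y0 yE [u [yu lt_u]]; rewrite ltNge; apply/negP => le_mu.
have : spectral_radius R G * \sum_v y v ^+ 2 < \sum_v y v * nbr_sum y v.
  apply: (@le_lt_trans _ _ (\sum_v y v * (mu * y v))).
    rewrite mulr_sumr; apply: ler_sum => v _.
    by rewrite expr2 mulrCA ler_wpM2l // ler_wpM2r.
  rewrite (bigD1 u) //= [X in _ < X](bigD1 u) //=; apply: ltr_leD.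
    by rewrite ltr_pM2l.
  by apply: ler_sum => v _; apply: ler_wpM2l.
by rewrite ltNge rayleigh.
Qed.

(** * Counting edges and moving one edge *)

Lemma eq_set_pair (T : finType) (a b c d : T) :
  ([set a; b] == [set c; d]) = (a == c) && (b == d) || (a == d) && (b == c).
Proof.
rewrite eqEsubset !subUset !sub1set !inE !(eq_sym c) !(eq_sym d).
by case: (a == c); case: (b == c); case: (a == d); case: (b == d).
Qed.

(** Each edge is the image of exactly two arcs. *)
Lemma handshake (G : sgraph) :
  (#|edges G| * 2 = \sum_(u : G) \sum_(v : G) adj u v)%N.
Proof.
pose arcs := [set p : G * G | adj p.1 p.2].
pose h (p : G * G) := [set p.1; p.2].
have -> : (\sum_(u : G) \sum_(v : G) adj u v = \sum_(p in arcs) 1)%N.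
  by rewrite pair_big [RHS]big_mkcond; apply: eq_bigr => p _; rewrite inE /=; case: (adj _ _).
have E : edges G = [set h p | p in arcs] by [].
rewrite (@partition_big_imset _ 0%N addn _ _ h arcs (fun _ => 1%N)).
rewrite -sum_nat_const E.
apply: eq_bigr => X /imsetP[[a b]]; rewrite inE /= => ab ->.
have nab : a != b by apply: contraTneq ab => ->; rewrite adj_irr.
rewrite (eq_bigl (pred2 (a, b) (b, a))) => [|[c d]].
  by rewrite sum1_card card2 xpair_eqE (negPf nab).
rewrite !inE /h /= eq_set_pair !xpair_eqE.
by apply: andb_idl => /orP[]/andP[/eqP-> /eqP->] //; rewrite adj_sym.
Qed.

Section Shift.
Variables (G : sgraph) (u v w : G).

(** Membership of the arc (a, b) in the edge {p, q}. *)
Definition is_pair (p q a b : G) := (a == p) && (b == q) || (a == q) && (b == p).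

(** The edge v w is replaced by u w.  The guard [u != w] makes the relation
    irreflexive for all u, v and w. *)
Definition shift_rel : rel G := fun a b =>
  (adj a b && ~~ is_pair v w a b) || ((u != w) && is_pair u w a b).

Lemma is_pair_sym p q : symmetric (is_pair p q).
Proof. by move=> a b; rewrite /is_pair orbC andbC [X in _ || X]andbC. Qed.

Lemma shift_sym : symmetric shift_rel.
Proof. by move=> a b; rewrite /shift_rel adj_sym !(is_pair_sym _ _ a). Qed.

Lemma shift_irr : irreflexive shift_rel.
Proof.
move=> a; rewrite /shift_rel adj_irr /is_pair /=.
by have [->|_] := eqVneq a u; rewrite /= ?andbF // andbT orbb andNb.
Qed.

Definition shift : sgraph := SGraph shift_sym shift_irr.

Hypotheses (uv : u != v) (wu : w != u) (avw : adj v w) (nauw : ~~ adj u w).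

(** Stated additively, to be summed against any weight: weight 1 counts edges,
    weight [x a * x b] gives the quadratic form. *)
Lemma shiftE a b :
  (shift_rel a b + is_pair v w a b = adj a b + is_pair u w a b)%N.
Proof.
have nvw : v != w by apply: contraTneq avw => ->; rewrite adj_irr.
have vu : v != u by rewrite eq_sym.
have uw : u != w by rewrite eq_sym.
rewrite /shift_rel uw /=.
have [/orP[]/andP[/eqP-> /eqP->]|_] := boolP (is_pair v w a b).
- by rewrite avw /is_pair (negPf vu) (negPf nvw).
- by rewrite adj_sym avw /is_pair (negPf wu) (negPf vu) andbF.
rewrite andbT addn0.
have [/orP[]/andP[/eqP-> /eqP->]|_] := boolP (is_pair u w a b); last first.
- by rewrite orbF addn0.
- by rewrite adj_sym (negPf nauw).
by rewrite (negPf nauw).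
Qed.

Lemma shift_sum (R : realType) (F : G -> G -> R) :
  \sum_a \sum_b (shift_rel a b)%:R * F a b =
  \sum_a \sum_b (adj a b)%:R * F a b + (F u w + F w u) - (F v w + F w v).
Proof.
have nvw : v != w by apply: contraTneq avw => ->; rewrite adj_irr.
have pairE p q : p != q ->
    \sum_a \sum_b (is_pair p q a b)%:R * F a b = F p q + F q p.
  move=> npq; have delta p' q' :
      \sum_a \sum_b ((a == p') && (b == q'))%:R * F a b = F p' q'.
    rewrite (bigD1 p') //= [X in _ + X]big1 => [|a /negPf ->]; last first.
      by rewrite big1 // => b _; rewrite mul0r.
    rewrite (bigD1 q') //= big1 => [|b /negPf ->]; last by rewrite andbF mul0r.
    by rewrite !eqxx mul1r !addr0.
  rewrite -(delta p q) -(delta q p) -big_split; apply: eq_bigr => a _ /=.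
  rewrite -big_split; apply: eq_bigr => b _ /=; rewrite -mulrDl -natrD /is_pair.
  congr (_%:R * _); case: (a =P p) => [->|_]; case: (b =P q) => [->|_] //=.
  by rewrite (negPf npq).
have uw : u != w by rewrite eq_sym.
apply/eqP; rewrite eq_sym subr_eq eq_sym -(pairE _ _ nvw) -(pairE _ _ uw) -!big_split.
apply/eqP/eq_bigr => a _ /=; rewrite -!big_split; apply: eq_bigr => b _ /=.
by rewrite -!mulrDl -!natrD shiftE.
Qed.

Lemma shift_edges : #|edges shift| = #|edges G|.
Proof.
apply/eqP; rewrite -(eqn_pmul2r (isT : (0 < 2)%N)) !handshake.
rewrite !pair_big /=.
have cp p q : p != q -> (\sum_(r : G * G) is_pair p q r.1 r.2 = 2)%N.
  move=> npq; rewrite -big_mkcond sum1_card (eq_card (B := pred2 (p, q) (q, p))).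
    by rewrite card2 xpair_eqE (negPf npq).
  by move=> [a b]; rewrite !inE !xpair_eqE.
have nvw : v != w by apply: contraTneq avw => ->; rewrite adj_irr.
rewrite -(eqn_add2r 2) -{1}(cp _ _ nvw) eq_sym -(cp u w) 1?eq_sym //.
by rewrite -!big_split; apply/eqP/eq_bigr => -[a b] _ /=; rewrite shiftE.
Qed.

End Shift.

(** The move adds 2 x_w (x_u - x_v) >= 0 to the quadratic form of x, while the
    radius cannot increase; so x stays an eigenvector for the same eigenvalue.
    But u has gained the neighbour w and lost none, so its equation fails. *)
Lemma maximizer_shift (R : realType) n e (G : sgraph) (x : G -> R) (u v w : G) :
  max_spectral_radius R n e G ->
  (forall a, 0 < x a) -> (forall a, nbr_sum x a = spectral_radius R G * x a) ->
  u != v -> w != u -> adj v w -> x v <= x u -> connected (shift u v w) ->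
  adj u w.
Proof.
move=> [[Gc Gn Ge] Gmax] x0 xE uv wu avw xvu Sc; apply: contraT => nauw.
set S := shift u v w in Sc.
have SC : classC n e S by split; rewrite ?shift_edges.
have := Gmax S SC; set rho := spectral_radius R G; set rho' := spectral_radius R S.
move=> le_rho.
have quad (H : sgraph) (y : H -> R) : \sum_a y a * nbr_sum y a =
    \sum_a \sum_b (adj a b)%:R * (y a * y b).
  apply: eq_bigr => a _; rewrite mulr_sumr; apply: eq_bigr => b _.
  by rewrite mulrCA.
pose xS : S -> R := x.
have X0 : 0 <= \sum_a x a ^+ 2 by apply: sumr_ge0 => a _; rewrite sqr_ge0.
have SE : \sum_a xS a * nbr_sum xS a =
    rho * \sum_a x a ^+ 2 + 2 * x w * (x u - x v).
  rewrite quad [LHS](shift_sum uv wu avw nauw (fun a b => x a * x b)) -quad.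
  rewrite mulr_sumr; rewrite (eq_bigr (fun a => rho * x a ^+ 2)); last first.
    by move=> a _; rewrite xE mulrCA.
  by ring.
have xvu' : 0 <= 2 * x w * (x u - x v).
  by rewrite mulr_ge0 ?mulr_ge0 ?subr_ge0 // ltW.
have eig : forall a, nbr_sum xS a = rho' * x a.
  apply: rayleigh_eq; rewrite -/rho'; apply: (@le_trans _ _ (rho * \sum_a x a ^+ 2)).
    by rewrite ler_wpM2r.
  by rewrite SE lerDl.
have := eig u; have := xE u; rewrite -/rho /nbr_sum => Eu Eu'.
have : \sum_b (adj u b)%:R * x b + x w <= \sum_b (adj (u : S) b)%:R * xS b.
  rewrite (bigD1 w) // [X in _ <= X](bigD1 w) //= (negPf nauw) mul0r add0r addrC.
  have -> : shift_rel u v w u w.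
    by rewrite /shift_rel /is_pair [u == w]eq_sym wu !eqxx orbT.
  rewrite mul1r; apply: lerD => //; apply: ler_sum => b bw.
  apply: ler_wpM2r; first exact/ltW/x0.
  rewrite ler_nat; have := shiftE uv wu avw nauw u b.
  rewrite /is_pair (negPf uv) (negPf bw) !(eq_sym u w) (negPf wu) !andbF /= !addn0.
  by move=> <-.
rewrite Eu Eu' => /le_trans/(_ (ler_wpM2r (ltW (x0 u)) le_rho)).
by rewrite gerDl leNgt x0.
Qed.

(** * Maximizers have a dominating vertex and nested neighbourhoods *)

(** The zeros of a nonnegative eigenvector are closed under adjacency. *)
Lemma perron_gt0 (R : realType) (G : sgraph) : connected G ->
  exists x : G -> R, (forall u, 0 < x u) /\
    forall u, nbr_sum x u = spectral_radius R G * x u.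
Proof.
move=> [G0 Gc]; have [x [x0 [a xa] xE]] := perron R G0.
exists x; split=> // u; rewrite lt_def x0 andbT.
apply: contra xa => /eqP xu.
have cl : closed (@adj G) [pred v | x v == 0].
  apply: intro_closed => [v w|v w vw]; first exact: (sym_connect_sym (@adj_sym G)).
  rewrite !inE => /eqP xv; have := xE v; rewrite xv mulr0 /nbr_sum => /eqP.
  rewrite psumr_eq0 => [/allP/(_ w)|b _]; last by rewrite mulr_ge0.
  by rewrite mem_index_enum vw mul1r; apply.
by have := closed_connect cl (Gc u a); rewrite !inE xu eqxx => /esym.
Qed.

(** Only the edge v w was removed. *)
Lemma shift_connected (G : sgraph) (u v w : G) :
  connected G -> connect (shift_rel u v w) v w -> connected (shift u v w).
Proof.
move=> [G0 Gc] vw; split=> // a b; have := Gc a b.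
apply: connect_sub => c d cd.
have [/orP[]/andP[/eqP-> /eqP->] //|ncd] := boolP (is_pair v w c d).
  by rewrite (sym_connect_sym (shift_sym u v w)).
by apply: connect1; rewrite /= /shift_rel cd ncd.
Qed.

(** The dominating vertex o is one with the largest value of x.  Were some
    vertex not adjacent to o, there would be a path o - b - w with w not
    adjacent to o, and moving b w to o w would keep the graph connected.
    Once o dominates, moves between other vertices keep the graph connected
    through o; this gives the last clause, nestedness. *)
Lemma maximizer_dominated (R : realType) n e (G : sgraph) :
  max_spectral_radius R n e G ->
  exists (o : G) (x : G -> R),
  [/\ forall u, 0 < x u, forall u, nbr_sum x u = spectral_radius R G * x u,
      x o = 1, forall v, v != o -> adj o v &
      forall u v w, u != o -> v != o -> w != o -> u != v -> w != u ->
        adj v w -> x v <= x u -> adj u w].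
Proof.
move=> Gmax; have [[Gc _ _] _] := Gmax.
have [x [x0 xE]] := perron_gt0 R Gc.
have [a0 _] : exists a0 : G, a0 \in G by apply/card_gt0P; case: Gc.
pose o := [arg max_(u > a0) x u]%O.
have o_max v : x v <= x o by rewrite /o; case: arg_maxP => // u _; apply.
have dom v : v != o -> adj o v.
  move=> vo; apply: contraT => nov.
  have [/existsP[b /existsP[w /and4P[ob bw wo now]]]|] := boolP
    [exists b, exists w, [&& adj o b, adj b w, w != o & ~~ adj o w]].
    have nbo : o != b by apply: contraNneq now => ->.
    apply: (contraNT _ now) => _.
    apply: (maximizer_shift Gmax x0 xE nbo wo bw (o_max b)).
    apply: shift_connected => //; apply: (connect_trans (y := o)).
      rewrite (sym_connect_sym (shift_sym o b w)).
      apply: connect1; rewrite /shift_rel ob /is_pair (negPf nbo).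
      by rewrite [o == w]eq_sym (negPf wo).
    by apply: connect1; rewrite /shift_rel /is_pair !eqxx [o == w]eq_sym wo /= orbT.
  rewrite negb_exists => /forallP h.
  have cl : closed (@adj G) [pred b | (b == o) || adj o b].
    apply: intro_closed => [b w|b w bw]; first exact: (sym_connect_sym (@adj_sym G)).
    rewrite !inE => /orP[/eqP <-|ob]; first by rewrite bw orbT.
    have := h b; rewrite negb_exists => /forallP/(_ w).
    by rewrite ob bw /= negb_and !negbK.
  have := closed_connect cl (Gc.2 o v).
  by rewrite !inE eqxx (negPf vo) (negPf nov).
have xo := x0 o.
exists o, (fun u => x u / x o); split=> //.
- by move=> u; rewrite divr_gt0.
- move=> u; rewrite mulrA -xE /nbr_sum mulr_suml.
  by apply: eq_bigr => v _; rewrite mulrA.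
- by rewrite divff // gt_eqF.
move=> u v w uo vo wo uv wu vw; rewrite ler_pM2r ?invr_gt0 // => xvu.
apply: (maximizer_shift Gmax x0 xE uv wu vw xvu).
have nvw : v != w by apply: contraTneq vw => ->; rewrite adj_irr.
have oe b : b != o -> b != u -> shift_rel u v w o b.
  move=> bo bu; rewrite /shift_rel dom // /is_pair.
  by rewrite !(eq_sym o) (negPf vo) (negPf wo).
apply: shift_connected => //; apply: (connect_trans (y := o)).
  rewrite (sym_connect_sym (shift_sym u v w)).
  by apply/connect1/oe; rewrite // eq_sym.
by apply/connect1/oe.
Qed.

(** * The graph V *)

Lemma sumV (M : nmodType) (n e : nat) (F : graphV n e -> M) :
  \sum_v F v = F (inl (inl (inl ord0))) + \sum_(i < e) F (inl (inl (inr i)))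
    + \sum_(j < n - e - 2) F (inl (inr j)) + F (inr ord0).
Proof. by rewrite /graphV /= !big_sumType /= !big_ord1. Qed.

Lemma classC_V (n e : nat) : (e + 2 <= n)%N -> classC n e (graphV n e).
Proof.
move=> en; split.
- split; first by apply/card_gt0P; exists (inr ord0).
  have hub (v : graphV n e) : connect (@adj (graphV n e)) v (inr ord0).
    case: v => [v|v]; first exact: connect1.
    by rewrite ord1 connect0.
  move=> u v; apply: connect_trans (hub u) _.
  by rewrite (sym_connect_sym (@adj_sym (graphV n e))).
- by rewrite !card_sum !card_ord; lia.
apply/eqP; rewrite -(eqn_pmul2r (isT : (0 < 2)%N)) handshake; apply/eqP.
have deg (u : graphV n e) : (\sum_(v : graphV n e) adj u v =
    match u with inl (inl (inl _)) => e.+1 | inl (inl (inr _)) => 2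
    | inl (inr _) => 1 | inr _ => n.-1 end)%N.
  by case: u => [[[i|i]|i]|i]; rewrite sumV /= !sum_nat_const !card_ord; lia.
rewrite (eq_bigr _ (fun u _ => deg u)) sumV /= !sum_nat_const !card_ord; lia.
Qed.

(** The test vector solves the eigenvector equations for mu at all vertices but
    the dominating one, where its value mu (mu^2 - e) is chosen to clear
    denominators; the last hypothesis is the strict inequality at that vertex. *)
Lemma lt_spectral_radius_V (R : realType) (n e : nat) (mu : R) :
  (e + 2 <= n)%N -> 0 < mu -> e%:R < mu ^+ 2 ->
  mu ^+ 2 * (mu ^+ 2 - e%:R) <
    (n%:R - 2 - e%:R) * (mu ^+ 2 - e%:R) + mu * ((e%:R + 1) * mu + 2 * e%:R) ->
  mu < spectral_radius R (graphV n e).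
Proof.
move=> en mu0 emu hmu.
have mE : (n - e - 2)%:R = n%:R - 2 - e%:R :> R.
  by rewrite -!subnDA !natrB ?natrD; [ring | lia].
have h0 : 0 < mu ^+ 2 - e%:R by rewrite subr_gt0.
have e0 : 0 <= e%:R :> R by [].
pose y (v : graphV n e) : R := match v with
  | inl (inl (inl _)) => mu * (mu + e%:R)
  | inl (inl (inr _)) => mu * (mu + 1)
  | inl (inr _) => mu ^+ 2 - e%:R
  | inr _ => mu * (mu ^+ 2 - e%:R) end.
have sums (c : R) m : \sum_(i < m) c = m%:R * c.
  by rewrite sumr_const card_ord mulr_natl.
have hubE : nbr_sum y (inr ord0) =
    (n%:R - 2 - e%:R) * (mu ^+ 2 - e%:R) + mu * ((e%:R + 1) * mu + 2 * e%:R).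
  by rewrite /nbr_sum sumV /= !sums mE; ring.
apply: (@lt_spectral_radius _ _ y).
- case=> [[[i|i]|i]|i] /=; last 1 [by rewrite mulr_ge0 // ltW] => //.
  + by rewrite mulr_ge0 ?addr_ge0 // ltW.
  + by rewrite mulr_ge0 ?addr_ge0 // ltW.
  exact: ltW.
- case=> [[[i|i]|i]|i]; rewrite ?ord1 ?hubE /nbr_sum ?sumV /= ?sums.
  + by rewrite le_eqVlt; apply/orP; left; apply/eqP; ring.
  + by rewrite le_eqVlt; apply/orP; left; apply/eqP; ring.
  + by rewrite le_eqVlt; apply/orP; left; apply/eqP; ring.
  + by apply: ltW; rewrite mulrA -expr2.
exists (inr ord0); rewrite hubE; split; first by rewrite /= mulr_gt0.
by rewrite /= mulrA -expr2.
Qed.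

(** * Isomorphism and the existence of a maximizer *)

Lemma iso_sym (G H : sgraph) : isomorphic G H -> isomorphic H G.
Proof.
move=> [f [[g fK gK] fE]]; exists g; split; first by exists f.
by move=> x y; rewrite -fE !gK.
Qed.

Lemma iso_classC n e (G H : sgraph) :
  isomorphic G H -> classC n e G -> classC n e H.
Proof.
move=> [f [fbij fE]] [[G0 Gc] Gn Ge]; have [g fK gK] := fbij.
have cardGH : #|G| = #|H| := bij_eq_card fbij.
split; last 1 first.
- rewrite -Ge; apply/eqP; rewrite -(eqn_pmul2r (isT : (0 < 2)%N)) !handshake.
  rewrite (reindex f) /=; last exact: onW_bij.
  apply/eqP/eq_bigr => u _; rewrite (reindex f) /=; last exact: onW_bij.
  by apply: eq_bigr => v _; rewrite fE.
- split=> [|a b]; first by rewrite -cardGH.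
  rewrite -[a]gK -[b]gK; have /connectP[p pth ->] := Gc (g a) (g b).
  elim: p (g a) pth => [|c p IH] d /=; first by rewrite connect0.
  case/andP => dc /IH; apply: connect_trans; apply: connect1.
  by rewrite fE.
by rewrite -cardGH.
Qed.

Lemma iso_spectral_radius_le (R : realType) (G H : sgraph) :
  (0 < #|G|)%N -> isomorphic G H -> spectral_radius R G <= spectral_radius R H.
Proof.
move=> G0 [f [fbij fE]]; have [g fK gK] := fbij.
have [x [x0 [a xa] xE]] := perron R G0.
have sq : 0 < \sum_u x u ^+ 2.
  rewrite (bigD1 a) //= ltr_wpDr ?sumr_ge0 // => [v _|]; first by rewrite sqr_ge0.
  by rewrite exprn_even_gt0.
rewrite -(ler_pM2r sq); have := rayleigh (fun v => x (g v)).
rewrite (reindex f) /=; last exact: onW_bij.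
rewrite [X in _ <= _ * X](reindex f) /=; last exact: onW_bij.
under [X in _ <= _ * X]eq_bigr do rewrite fK.
apply: le_trans; rewrite mulr_sumr; apply: ler_sum => u _.
rewrite fK expr2 mulrCA -xE ler_wpM2l // /nbr_sum [X in _ <= X](reindex f) /=.
  by apply: ler_sum => v _; rewrite fE fK.
exact: onW_bij.
Qed.

Section Enumerate.
Variables (n : nat) (c : {ffun 'I_n * 'I_n -> bool}).
(** Symmetrizing an arbitrary boolean matrix makes every code a graph, so that
    graphs on n vertices are indexed by a finite type. *)
Definition code_rel : rel 'I_n := fun i j => (i != j) && (c (i, j) || c (j, i)).

Lemma code_sym : symmetric code_rel.
Proof. by move=> i j; rewrite /code_rel eq_sym orbC. Qed.

Lemma code_irr : irreflexive code_rel.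
Proof. by move=> i; rewrite /code_rel eqxx. Qed.

Definition code_graph := SGraph code_sym code_irr.
End Enumerate.

Lemma code_graphP (G : sgraph) n : #|G| = n ->
  exists c : {ffun 'I_n * 'I_n -> bool}, isomorphic G (code_graph c).
Proof.
move=> Gn; pose f u : 'I_n := cast_ord Gn (enum_rank u).
pose g (i : 'I_n) : G := enum_val (cast_ord (esym Gn) i).
have fK : cancel f g by move=> u; rewrite /f /g cast_ordK enum_rankK.
have gK : cancel g f by move=> i; rewrite /f /g enum_valK cast_ordKV.
exists [ffun p => adj (g p.1) (g p.2)], f; split; first by exists g.
move=> u v; rewrite /= /code_rel !ffunE /= !fK (adj_sym v) orbb.
rewrite (inj_eq (can_inj fK)); case: eqVneq => [->|] //=.
by rewrite adj_irr.
Qed.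

Lemma maximizer_exists (R : realType) n e (G : sgraph) :
  classC n e G -> exists M, max_spectral_radius R n e M.
Proof.
move=> GC; have [_ Gn _] := GC; have [c0 iso0] := code_graphP Gn.
pose P (c : {ffun 'I_n * 'I_n -> bool}) := `[< classC n e (code_graph c) >].
have P0 : P c0 by apply/asboolP/(iso_classC iso0).
case: (arg_maxP (fun c => spectral_radius R (code_graph c)) P0) => c /asboolP Pc cmax.
exists (code_graph c); split=> // H HC; have [[H0 _] Hn _] := HC.
have [d isod] := code_graphP Hn.
apply: le_trans (iso_spectral_radius_le R H0 isod) (cmax d _).
exact/asboolP/(iso_classC isod).
Qed.

(** * Real inequalities above the threshold *)

(** The hypothesis [l * (k + 1) <= e * (l - k)] says that l is at least
    e k / (e - k - 1).  This quantity decreases in e, so its value at the largest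
    e below C(k+1, 2), where 2 e = (k + 2) (k - 1), is a lower bound for l. *)
Lemma ell_lower (R : realFieldType) (e k l : R) :
  3 <= k -> 0 <= e -> 2 * e <= (k + 2) * (k - 1) -> 0 < l ->
  l * (k + 1) <= e * (l - k) ->
  [/\ k * (k + 2) * (k - 1) <= l * (k ^+ 2 - k - 4), k + 2 < l
    & 2 * e <= l ^+ 2 - l].
Proof.
move=> k3 e0 ek l0 hl.
have lk : 0 < l - k.
  rewrite ltNge; apply/negP => lk.
  have := mulr_ge0_le0 e0 lk; have : 0 < l * (k + 1) by rewrite mulr_gt0 //; lra.
  by lra.
have : 2 * e * (l - k) <= (k + 2) * (k - 1) * (l - k) by rewrite ler_wpM2r // ltW.
move=> h; have X : k * (k + 2) * (k - 1) <= l * (k ^+ 2 - k - 4) by lra.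
have m0 : 0 < k ^+ 2 - k - 4 by nra.
have lk2 : k + 2 < l by rewrite -(ltr_pM2r m0); apply: lt_le_trans X; lra.
split=> //; have : 0 <= (l - (k + 2)) * (l + k + 1) by apply: mulr_ge0; lra.
by lra.
Qed.

(** The right-hand side is 5 T ((2 e - 6) / 5), with T as in the proof of
    [psi_gt0].  With m = k^2 - k - 4 and q = (k + 2) (k - 1), the bound
    l m >= k q and the inequalities m <= 2 (e - 3) and 2 e <= q reduce the claim
    to the positivity of a polynomial in k alone, named slack below, which holds
    from k = 5 on. *)
Lemma far_end_gt0_large (R : realFieldType) (e k l : R) :
  5 <= k -> k * (k - 1) + 2 <= 2 * e -> 2 * e <= (k + 2) * (k - 1) -> 0 < l ->
  l * (k + 1) < e * (l - k) ->
  0 < 3 * (e - 3) * l ^+ 2 - (16 * e - 18) * l - 4 * e * (e - 3).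
Proof.
move=> k5 ek ek' l0 hl.
have k0 : 0 <= k * (k - 1) by rewrite mulr_ge0 //; lra.
have [||X _ _] := @ell_lower _ e k l _ _ ek' l0 (ltW hl); try lra.
pose m := k ^+ 2 - k - 4; pose q := (k + 2) * (k - 1).
have m0 : 0 < m by rewrite /m; nra.
have mf : m <= 2 * (e - 3) by rewrite /m; lra.
have f0 : 0 < e - 3 by lra.
have q0 : 0 < q by rewrite /q; nra.
have slack : 0 < k * (3 * k * q - 16 * m - 60) - 2 * m ^+ 2.
  have -> : k * (3 * k * q - 16 * m - 60) - 2 * m ^+ 2 =
      (k - 5) ^+ 4 + 11 * (k - 5) ^+ 3 + 39 * (k - 5) ^+ 2 + 53 * (k - 5) + 8.
    by rewrite /m /q; ring.
  have z0 : 0 <= k - 5 by lra.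
  have := exprn_ge0 2 z0; have := exprn_ge0 3 z0; have := exprn_ge0 4 z0.
  by lra.
have c0 : 0 < 3 * k * q - 16 * m - 60.
  have : 0 < k * (3 * k * q - 16 * m - 60) by have := sqr_ge0 m; lra.
  by rewrite pmulr_rgt0 //; lra.
have g0 : 0 < 3 * (l * m) ^+ 2 - (16 * m + 60) * (l * m) - 2 * q * m ^+ 2.
  have h1 : k * q * (3 * k * q - 16 * m - 60) <= l * m * (3 * (l * m) - 16 * m - 60).
    apply: ler_pM; [by rewrite mulr_ge0 //; lra | by apply: ltW | | ].
      by rewrite /q /m; lra.
    by rewrite /q /m; lra.
  have h2 : 0 < q * (k * (3 * k * q - 16 * m - 60) - 2 * m ^+ 2) by apply: mulr_gt0.
  by lra.
have g1 : 0 < 3 * l ^+ 2 * m - (16 * m + 60) * l - 2 * q * m.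
  rewrite -(pmulr_rgt0 _ m0); apply: lt_le_trans g0 _.
  by rewrite le_eqVlt; apply/orP; left; apply/eqP; ring.
rewrite -(pmulr_rgt0 _ m0).
have h1 : 0 < (e - 3) * (3 * l ^+ 2 * m - (16 * m + 60) * l - 2 * q * m) by apply: mulr_gt0.
have h2 : l * m <= l * (2 * (e - 3)) by rewrite ler_wpM2l // ltW.
have h3 : (e - 3) * m * (2 * e) <= (e - 3) * m * q.
  by rewrite ler_wpM2l // mulr_ge0 // ltW.
by lra.
Qed.

(** The crude bounds of [far_end_gt0_large] fail for k = 3 and k = 4; these leave
    only five values of e, which the hypothesis on l settles one by one. *)
Lemma far_end_gt0 (R : realFieldType) (e k : nat) (l : R) :
  (3 <= k)%N -> (k * (k - 1) + 2 <= 2 * e)%N -> (2 * e + 2 <= k * (k + 1))%N ->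
  0 < l -> l * (k%:R + 1) < e%:R * (l - k%:R) ->
  0 < 3 * (e%:R - 3) * l ^+ 2 - (16 * e%:R - 18) * l - 4 * e%:R * (e%:R - 3).
Proof.
move=> k3 ek ek' l0 hl.
have [k5|k5] := leqP 5 k.
  apply: (@far_end_gt0_large _ _ k%:R) => //; first by rewrite (ler_nat _ 5).
    by move: ek; rewrite -(ler_nat R) natrD !natrM natrB //; lia.
  by move: ek'; rewrite -(ler_nat R) natrD !natrM natrD; lra.
have [E|[E|[E|[E|E]]]] : (k = 3 /\ e = 4) \/ (k = 3 /\ e = 5) \/ (k = 4 /\ e = 7)
    \/ (k = 4 /\ e = 8) \/ (k = 4 /\ e = 9).
- have [?|?] : (k = 3)%N \/ (k = 4)%N by lia.
    by subst k; have : (e = 4 \/ e = 5)%N; lia.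
  by subst k; have : (e = 7 \/ e = 8 \/ e = 9)%N; lia.
all: case: E hl => -> -> hl; nra.
Qed.

(** The constraint 2 e = 6 + 2 Q + d + P makes the difference of the two sides,
    for fixed P, an affine decreasing function of d; so d may be raised to the
    value D at which the constraint 2 d <= Q becomes an equality.  There the
    difference factors as l (l + 1) T(D) with T affine.  If D <= k - 2, the bound
    P <= D^2 gives (D + 2) (D + 3) >= 2 e and T(D) is at least
    (l + D) ((l + e) (l - D - 2) - l (l + 1)), positive by the choice of l; this
    is the case of near-cliques.  Otherwise D lies between k - 2 and
    (2 e - 6) / 5, and the affine T is positive at both ends. *)
Lemma psi_gt0 (R : realFieldType) (l e k d P Q : R) :
  3 <= k -> 5 <= e -> 0 < l -> 2 * e <= (k + 2) * (k - 1) ->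
  l * (k + 1) < e * (l - k) ->
  0 < 3 * (e - 3) * l ^+ 2 - (16 * e - 18) * l - 4 * e * (e - 3) ->
  0 <= d -> 0 <= P -> P <= d ^+ 2 -> 2 * d <= Q -> 2 * e = 6 + 2 * Q + d + P ->
  (l + d) * (l * (l + 1)) ^+ 2 <
  (l + e) * ((l ^+ 2 - l - Q) * (l ^+ 2 - P) - 2 * (l + d) * (l + P)).
Proof.
move=> k3 e5 l0 ek hl hend d0 P0 Pd dQ eE.
have [_ lk2 l2'] := ell_lower k3 (le_trans (ler0n _ 5) e5) ek l0 (ltW hl).
pose T x := (l + e) * (l ^+ 2 - 2 * l - 2 * e + 6 + 3 * x) - (l + x) * (l * (l + 1)).
pose D := (2 * e - 6 - P) / 5.
have PE : P = 2 * e - 6 - 5 * D by rewrite /D; field.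
have dD : d <= D by rewrite /D; lra.
have QE : Q = e - 3 - (d + P) / 2 by lra.
have l2 : 2 * e <= l ^+ 2 by lra.
have TD : 0 < T D.
  have [Dk|kD] := lerP D (k - 2).
    have h1 : (l - D - 2) * (l + D) <= l ^+ 2 - 2 * l - 2 * e + 6 + 3 * D by nra.
    have h2 : (l + D) * ((l + e) * (l - D - 2) - l * (l + 1)) <= T D.
      have : (l + e) * ((l - D - 2) * (l + D)) <= (l + e) * (l ^+ 2 - 2 * l - 2 * e + 6 + 3 * D).
        by rewrite ler_wpM2l //; lra.
      by rewrite /T; lra.
    apply: lt_le_trans h2; apply: mulr_gt0; first lra.
    have : (l + e) * (l - k) <= (l + e) * (l - D - 2) by rewrite ler_wpM2l //; lra.
    by lra.
  have T0 : 0 < T (k - 2).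
    have : 0 < (l + k - 2) * ((l + e) * (l - k) - l * (l + 1)).
      by apply: mulr_gt0; lra.
    have : (l + e) * ((l + k - 2) * (l - k)) <= (l + e) * (l ^+ 2 - 2 * l - 2 * e + 6 + 3 * (k - 2)).
      by rewrite ler_wpM2l //; nra.
    by rewrite /T; lra.
  pose E := (2 * e - 6) / 5.
  have T1 : 0 < T E.
    have -> : T E = (3 * (e - 3) * l ^+ 2 - (16 * e - 18) * l - 4 * e * (e - 3)) / 5.
      by rewrite /T /E; field.
    by rewrite divr_gt0.
  have DE : D <= E by rewrite /D /E; lra.
  have Tlin x y : T y - T x = (y - x) * (3 * (l + e) - l * (l + 1)) by rewrite /T; ring.
  have [s0|s0] := lerP 0 (3 * (l + e) - l * (l + 1)).
    have : 0 <= (D - (k - 2)) * (3 * (l + e) - l * (l + 1)) by apply: mulr_ge0; lra.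
    by have := Tlin (k - 2) D; lra.
  have : (E - D) * (3 * (l + e) - l * (l + 1)) <= 0 by apply: mulr_ge0_le0; lra.
  by have := Tlin D E; lra.
have : 0 < l * (l + 1) * T D by apply: mulr_gt0 => //; apply: mulr_gt0; lra.
have slope : 0 <= (l * (l + 1)) ^+ 2 - (l + e) * ((l ^+ 2 - P) / 2 - 2 * (l + P)).
  have h1 : (l + e) * ((l ^+ 2 - P) / 2 - 2 * (l + P)) <= (l + e) * l ^+ 2.
    by rewrite ler_wpM2l //; nra.
  have h2 : (l + e) * l ^+ 2 <= (l + 1) ^+ 2 * l ^+ 2.
    by rewrite ler_wpM2r ?sqr_ge0 //; nra.
  by rewrite exprMn mulrC; lra.
have : 0 <= (D - d) * ((l * (l + 1)) ^+ 2 - (l + e) * ((l ^+ 2 - P) / 2 - 2 * (l + P))).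
  by apply: mulr_ge0; lra.
set A := (D - d) * _; set B := l * (l + 1) * _; set C := _ ^+ 2.
suff -> : (l + e) * ((l ^+ 2 - l - Q) * (l ^+ 2 - P) - 2 * (l + d) * (l + P)) =
    (l + d) * C + A + B by lra.
by rewrite /A /B /C /T QE PE; field.
Qed.

(** Here s and c stand for x p1 + x p2 and x p3: eliminating s leaves c times
    the bracket of [psi_gt0] at most (l + d) l (l + 1). *)
Lemma third_bound (R : realFieldType) (l e k d P Q s c : R) :
  3 <= k -> 5 <= e -> 0 < l -> 2 * e <= (k + 2) * (k - 1) ->
  l * (k + 1) < e * (l - k) ->
  0 < 3 * (e - 3) * l ^+ 2 - (16 * e - 18) * l - 4 * e * (e - 3) ->
  0 <= d -> 0 <= P -> P <= d ^+ 2 -> 2 * d <= Q -> 2 * e = 6 + 2 * Q + d + P ->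
  (l ^+ 2 - l - Q) * s <= 2 * l + Q + 2 * (l + P) * c ->
  (l ^+ 2 - P) * c <= (l + d) * (1 + s) ->
  c * (l * (l + 1)) < l + e.
Proof.
move=> k3 e5 l0 ek hl hend d0 P0 Pd dQ eE hs hc.
have psi := psi_gt0 k3 e5 l0 ek hl hend d0 P0 Pd dQ eE.
have [_ lk2 l2'] := ell_lower k3 (le_trans (ler0n _ 5) e5) ek l0 (ltW hl).
set K := _ - _ in psi.
have A1 : 0 < l ^+ 2 - l - Q by lra.
have ld : 0 < l + d by lra.
have ll : 0 < l * (l + 1) by rewrite mulr_gt0 //; lra.
have cK : c * K <= (l + d) * (l * (l + 1)).
  have h1 := ler_wpM2l (ltW A1) hc.
  have h2 := ler_wpM2l (ltW ld) hs.
  by rewrite /K; lra.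
have K0 : 0 < K.
  rewrite -(pmulr_rgt0 _ (_ : 0 < l + e)); last lra.
  by apply: le_lt_trans psi; rewrite mulr_ge0 ?sqr_ge0 // ltW.
rewrite ltNge; apply/negP => h.
have h1 := ler_wpM2r (ltW K0) h.
have h2 := ler_wpM2r (ltW ll) cK.
by lra.
Qed.

(** Here a = x p1 and s is the sum of x over the vertices S other than o and p1;
    p counts the neighbours of p1 in S, w the edges inside S, and Z sums
    x u + x v over these edges.  The equation for l a and the bound on Z
    bound a from above; the last hypothesis, which says that V does not have a
    larger radius, bounds it from below once s is eliminated.  The two bounds
    together are w times the conclusion. *)
Lemma center_contradiction (R : realFieldType) (l e n p w a c s Z : R) :
  0 < l -> e < l ^+ 2 -> 0 < w -> e = p + w ->
  l = a + s -> l * s = n - 2 + p * a + Z -> l * (l * a - 1) = p + p * a + Z ->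
  Z <= w * (a + c) ->
  (n - 2 - e) * (l ^+ 2 - e) + l * ((e + 1) * l + 2 * e) <= l ^+ 2 * (l ^+ 2 - e) ->
  l + e <= c * (l * (l + 1)).
Proof.
move=> l0 el w0 eE lE hs ha hZ hn.
have le0 : 0 < l ^+ 2 - e by lra.
have sE : s = l - a by lra.
have nE : n - 2 - e = l ^+ 2 + l - w - l * (l + 1) * a by rewrite eE; rewrite sE in hs; lra.
have h1 : a * (l ^+ 2 - e) <= l + p + w * c by rewrite eE; lra.
have ll : 0 < l * (l + 1) by rewrite mulr_gt0 //; lra.
have h2 := ler_wpM2l (ltW ll) h1.
rewrite -(ler_pM2l w0) -subr_ge0.
rewrite nE in hn.
have -> : w * (c * (l * (l + 1))) - w * (l + e) =
  (l * (l + 1) * (l + p + w * c) - l * (l + 1) * (a * (l ^+ 2 - e))) +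
  (l ^+ 2 * (l ^+ 2 - e) - ((l ^+ 2 + l - w - l * (l + 1) * a) * (l ^+ 2 - e) + l * ((e + 1) * l + 2 * e))).
  by rewrite eE; ring.
by apply: addr_ge0; rewrite subr_ge0.
Qed.

(** * All edges of a maximizer meet one of two vertices *)

Lemma exists_max (R : realType) (T : finType) (P : pred T) (x : T -> R) v0 :
  P v0 -> exists p, P p /\ forall v, P v -> x v <= x p.
Proof. by move=> Pv; case: (arg_maxP x Pv) => p Pp pmax; exists p. Qed.

Section Sums.
Variables (R : realType) (G : sgraph).
Local Notation A u v := ((adj u v)%:R : R).

(** Peels one vertex off a count of arcs; applied to o, p1, p2 and p3 in turn. *)
Lemma double_sum_split (P : pred G) q : P q ->
  \sum_(u | P u) \sum_(v | P v) A u v =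
  2 * \sum_(v | P v && (v != q)) A q v
  + \sum_(u | P u && (u != q)) \sum_(v | P v && (v != q)) A u v.
Proof.
move=> Pq; rewrite (bigD1 q) //= (bigD1 q) //= adj_irr add0r.
rewrite [X in _ + X = _](eq_bigr (fun u => A q u + \sum_(v | P v && (v != q)) A u v)).
  by rewrite big_split /=; ring.
by move=> u _; rewrite (bigD1 q) //= adj_sym.
Qed.

Lemma handshakeR (n e : nat) : classC n e G ->
  \sum_(u : G) \sum_(v : G) A u v = 2 * (n%:R - 1 + e%:R).
Proof.
move=> [[G0 _] Gn Ge]; have := handshake G; rewrite Ge => /(congr1 (fun m => m%:R : R)).
rewrite !natrM natrD natrB -?Gn // natr_sum mulrC => ->.
by apply: eq_bigr => u _; rewrite natr_sum.
Qed.

End Sums.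

Section DominatedMaximizer.
Variables (R : realType) (n e k : nat) (G : sgraph) (o : G) (x : G -> R).
Local Notation A u v := ((adj u v)%:R : R).
Let l := spectral_radius R G.
Hypothesis GC : classC n e G.
Hypothesis x0 : forall u, 0 < x u.
Hypothesis xE : forall u, nbr_sum x u = l * x u.
Hypothesis xo : x o = 1.
Hypothesis dom : forall v, v != o -> adj o v.
Hypothesis nest : forall u v w, u != o -> v != o -> w != o -> u != v -> w != u ->
        adj v w -> x v <= x u -> adj u w.

Lemma adj_mul_absorb (u v w z : G) : (adj u v -> adj w z) -> A u v * A w z = A u v.
Proof. by case: (adj u v) => [->|]; rewrite ?mulr1 ?mul0r. Qed.

Section Top.
Variable p1 : G.
Hypothesis p1o : p1 != o.
Hypothesis p1max : forall v, v != o -> x v <= x p1.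
Let S v := (v != o) && (v != p1).
Let a := x p1.
Let p := \sum_(v | S v) A p1 v.
Let Z := \sum_(v | S v) \sum_(u | S u) A v u * x u.
Let W2 := \sum_(v | S v) \sum_(u | S u) A v u.

(** Nestedness compared at the other end v of the edge, where x v <= x p1. *)
Lemma dom1 u v : S u -> S v -> adj u v -> adj p1 u.
Proof.
move=> /andP[uo up] /andP[vo vp] uv; apply: (nest (v := v)) => //.
- by rewrite eq_sym.
- by rewrite adj_sym.
exact: p1max.
Qed.

Lemma split_sum (F : G -> R) : \sum_v F v = F o + (F p1 + \sum_(v | S v) F v).
Proof. by rewrite (bigD1 o) //= (bigD1 p1). Qed.

Lemma card_S : \sum_(v | S v) (1 : R) = n%:R - 2.
Proof.
have := split_sum (fun _ => 1); rewrite sumr_const cardT -cardE.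
by case: GC => _ -> _ ->; ring.
Qed.

Lemma eq_o : l = a + \sum_(v | S v) x v.
Proof.
have := xE o; rewrite xo mulr1 /nbr_sum split_sum adj_irr dom // mul0r add0r mul1r => <-.
by congr (_ + _); apply: eq_bigr => v /andP[vo _]; rewrite dom // mul1r.
Qed.

Lemma eq_p1 : l * a = 1 + \sum_(v | S v) A p1 v * x v.
Proof.
by rewrite /a -xE /nbr_sum split_sum adj_irr adj_sym dom // xo mul0r add0r mulr1.
Qed.

Lemma eq_S v : S v -> l * x v = 1 + (A p1 v * a + \sum_(u | S u) A v u * x u).
Proof.
move=> /andP[vo _]; rewrite -xE /nbr_sum split_sum adj_sym dom // xo.
by rewrite (adj_sym v) mulr1.
Qed.

Lemma eq_sumS : l * \sum_(v | S v) x v = n%:R - 2 + p * a + Z.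
Proof.
rewrite mulr_sumr (eq_bigr _ eq_S) !big_split /= card_S mulr_suml.
by rewrite addrA.
Qed.

(** Summing over the neighbours of p1 alone leaves Z unchanged: an edge inside S
    has both its ends adjacent to p1. *)
Lemma eq_sumN : l * (l * a - 1) = p + p * a + Z.
Proof.
rewrite eq_p1 addrC addKr mulr_sumr /p mulr_suml /Z -!big_split /=.
apply: eq_bigr => v Sv; rewrite mulrCA eq_S // !mulrDr mulr1 mulrA.
rewrite (adj_mul_absorb (fun h => h)) addrA; congr (_ + _); rewrite mulr_sumr.
apply: eq_bigr => u Su; rewrite mulrA [_ * A v u]mulrC adj_mul_absorb //.
exact: dom1.
Qed.

Lemma eq_edges : 2 * e%:R = 2 * p + W2.
Proof.
have := handshakeR R GC; rewrite (@double_sum_split _ _ xpredT o) //=.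
rewrite (@double_sum_split _ _ (fun v => v != o) p1) //= -/p -/W2.
rewrite (eq_bigr (fun _ => 1)) => [|v vo]; last by rewrite dom.
rewrite (bigD1 p1) //= card_S; lra.
Qed.

(** The double sum counts each edge from both of its ends, so that its
    symmetrization is a sum of x u + x v over arcs. *)
Lemma Z_le c : (forall u v, S u -> S v -> adj u v -> x u + x v <= a + c) ->
  Z <= W2 / 2 * (a + c).
Proof.
move=> h; have Z2 : Z = \sum_(v | S v) \sum_(u | S u) A v u * x v.
  rewrite /Z exchange_big; apply: eq_bigr => u _; apply: eq_bigr => v _.
  by rewrite adj_sym.
suff : Z + Z <= W2 * (a + c) by lra.
rewrite {1}Z2 /Z -big_split /W2 mulr_suml; apply: ler_sum => v Sv.
rewrite -big_split mulr_suml; apply: ler_sum => u Su /=.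
rewrite -mulrDr; case vu: (adj v u); last by rewrite !mul0r.
by rewrite !mul1r h.
Qed.

Section Triangle.
Variables p2 p3 : G.
Hypothesis Sp2 : S p2.
Hypothesis p2max : forall v, S v -> x v <= x p2.
Let S2 v := S v && (v != p2).
Hypothesis Sp3 : S2 p3.
Hypothesis p3max : forall v, S2 v -> x v <= x p3.
Let S3 v := S2 v && (v != p3).
Hypotheses (a12 : adj p1 p2) (a13 : adj p1 p3) (a23 : adj p2 p3).
Let b := x p2.
Let c := x p3.
Let D1 := \sum_(v | S3 v) A p1 v.
Let D2 := \sum_(v | S3 v) A p2 v.
Let D3 := \sum_(v | S3 v) A p3 v.
Let W := \sum_(v | S3 v) \sum_(u | S3 u) A v u.

Lemma S3P v : S3 v -> [/\ v != o, v != p1, v != p2 & v != p3].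
Proof. by case/andP => /andP[/andP[]]. Qed.

Lemma split_S (F : G -> R) :
  \sum_(v | S v) F v = F p2 + (F p3 + \sum_(v | S3 v) F v).
Proof. by rewrite (bigD1 p2) //= (bigD1 p3). Qed.

Lemma nest2 v : S3 v -> adj p2 v -> adj p1 v.
Proof.
case/S3P => vo v1 v2 v3 h; case/andP: (Sp2) => p2o p21.
by apply: (nest (v := p2)) => //; [rewrite eq_sym | exact: p1max].
Qed.

Lemma nest3 v : S3 v -> adj p3 v -> adj p2 v.
Proof.
case/S3P => vo v1 v2 v3 h; case/andP: (Sp3) => /andP[p3o p31] p32.
case/andP: (Sp2) => p2o p21.
apply: (nest (v := p3)) => //; [by rewrite eq_sym | apply: p2max; exact/andP].
Qed.

Lemma nest4 u v : S3 u -> S3 v -> adj u v -> adj p3 u.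
Proof.
move=> /S3P[uo u1 u2 u3] Sv uv; case/S3P: (Sv) => vo v1 v2 v3.
case/andP: (Sp3) => /andP[p3o p31] p32.
apply: (nest (v := v)) => //; [by rewrite eq_sym | by rewrite adj_sym |].
by apply: p3max; case/andP: Sv.
Qed.

Lemma eq_S3 v : S3 v -> l * x v =
  1 + (A p1 v * a + (A p2 v * b + (A p3 v * c + \sum_(u | S3 u) A v u * x u))).
Proof.
move=> Sv; have Sv' : S v by case/andP: Sv => /andP[].
by rewrite (eq_S Sv') split_S !(adj_sym v).
Qed.

(** Both ends of an edge off the triangle are neighbours of p3, so these edges
    live on a set of D3 vertices. *)
Lemma W_le : W <= D3 ^+ 2 - D3.
Proof.
have -> : D3 ^+ 2 - D3 = \sum_(v | S3 v) \sum_(u | S3 u)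
    (A p3 v * A p3 u - A p3 v * (u == v)%:R).
  rewrite expr2 {1}/D3 mulr_suml /D3 -sumrB; apply: eq_bigr => v Sv.
  rewrite sumrB -mulr_sumr; congr (_ - _).
  rewrite (bigD1 v) //= eqxx mulr1 big1 ?addr0 // => u /andP[_ /negPf->].
  by rewrite mulr0.
apply: ler_sum => v Sv; apply: ler_sum => u Su.
have [->|uv] := eqVneq u v; first by rewrite adj_irr mulr1 (adj_mul_absorb (fun h => h)) subrr.
rewrite mulr0 subr0; case vu: (adj v u); last by rewrite mulr_ge0.
have uv' : adj u v by rewrite adj_sym.
by rewrite (nest4 Sv Su vu) (nest4 Su Sv uv') mulr1.
Qed.

Lemma W_edges : 2 * e%:R = 6 + 2 * (D1 + D2 + D3) + W.
Proof.
rewrite eq_edges /W2 (@double_sum_split _ _ S p2) //.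
rewrite (@double_sum_split _ _ S2 p3) // -/W.
rewrite /p split_S -/D1 a12 a13.
rewrite (bigD1 p3) //= a23 -/D2 -/D3 /=.
by ring.
Qed.

Lemma tail_le (q : G) :
  \sum_(v | S3 v) A q v * \sum_(u | S3 u) A v u * x u <= W * c.
Proof.
rewrite /W mulr_suml; apply: ler_sum => v Sv.
have : \sum_(u | S3 u) A v u * x u <= (\sum_(u | S3 u) A v u) * c.
  rewrite mulr_suml; apply: ler_sum => u Su; apply: ler_wpM2l => //.
  by apply: p3max; case/andP: Su.
apply: le_trans; case: (adj q v); rewrite ?mul1r // mul0r.
by apply: sumr_ge0 => u _; rewrite mulr_ge0 // ltW.
Qed.

(** The second application of the eigenvector equations, at the neighbours of q
    off the triangle. *)
Lemma expand_top (q : G) : l * \sum_(v | S3 v) A q v * x v =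
  \sum_(v | S3 v) A q v + (\sum_(v | S3 v) A q v * A p1 v) * a
  + (\sum_(v | S3 v) A q v * A p2 v) * b + (\sum_(v | S3 v) A q v * A p3 v) * c
  + \sum_(v | S3 v) A q v * \sum_(u | S3 u) A v u * x u.
Proof.
rewrite mulr_sumr !mulr_suml -!big_split; apply: eq_bigr => v Sv /=.
by rewrite mulrCA eq_S3 //; ring.
Qed.

(** The products of adjacencies collapse by nestedness: off the triangle,
    neighbours of p3 are neighbours of p2, and these are neighbours of p1. *)
Lemma top_a : l ^+ 2 * a <= l * (1 + b + c) + D1 + D1 * a + D2 * b + (D3 + W) * c.
Proof.
have e2 : \sum_(v | S3 v) A p1 v * A p2 v = D2.
  by apply: eq_bigr => v Sv; rewrite mulrC adj_mul_absorb //; apply: nest2.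
have e3 : \sum_(v | S3 v) A p1 v * A p3 v = D3.
  apply: eq_bigr => v Sv; rewrite mulrC adj_mul_absorb // => h.
  by apply/nest2/nest3.
have e1 : \sum_(v | S3 v) A p1 v * A p1 v = D1.
  by apply: eq_bigr => v Sv; rewrite adj_mul_absorb.
rewrite expr2 -mulrA eq_p1 split_S a12 a13 -/b -/c !mul1r !mulrDr expand_top e1 e2 e3 -/D1.
have := tail_le p1; lra.
Qed.

Lemma top_b : l ^+ 2 * b <= l * (1 + a + c) + D2 + D2 * a + D2 * b + (D3 + W) * c.
Proof.
have e1 : \sum_(v | S3 v) A p2 v * A p1 v = D2.
  by apply: eq_bigr => v Sv; rewrite adj_mul_absorb //; apply: nest2.
have e3 : \sum_(v | S3 v) A p2 v * A p3 v = D3.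
  by apply: eq_bigr => v Sv; rewrite mulrC adj_mul_absorb //; apply: nest3.
have e2 : \sum_(v | S3 v) A p2 v * A p2 v = D2.
  by apply: eq_bigr => v Sv; rewrite adj_mul_absorb.
rewrite expr2 -mulrA (eq_S Sp2) split_S a12 adj_irr a23 -/b -/c !mul1r mul0r !mulrDr expand_top e1 e2 e3 -/D2.
have := tail_le p2; lra.
Qed.

Lemma top_c : l ^+ 2 * c <= l * (1 + a + b) + D3 + D3 * a + D3 * b + (D3 + W) * c.
Proof.
have e1 : \sum_(v | S3 v) A p3 v * A p1 v = D3.
  by apply: eq_bigr => v Sv; rewrite adj_mul_absorb // => h; apply/nest2/nest3.
have e2 : \sum_(v | S3 v) A p3 v * A p2 v = D3.
  by apply: eq_bigr => v Sv; rewrite adj_mul_absorb //; apply: nest3.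
have e3 : \sum_(v | S3 v) A p3 v * A p3 v = D3.
  by apply: eq_bigr => v Sv; rewrite adj_mul_absorb.
have Sp3' : S p3 by case/andP: Sp3.
rewrite expr2 -mulrA (eq_S Sp3') split_S a13 adj_irr (adj_sym p3) a23 -/b -/c !mul1r mul0r !mulrDr expand_top e1 e2 e3 -/D3.
have := tail_le p3; lra.
Qed.

(** The values at p1 and p2 enter only through their sum, which is legitimate
    because D2 <= D1 lets both be weighted by D1 + D2. *)
Lemma third_le : 3 <= k%:R :> R -> 5 <= e%:R :> R ->
  2 * e%:R <= (k%:R + 2) * (k%:R - 1) :> R ->
  0 < l -> l * (k%:R + 1) < e%:R * (l - k%:R) ->
  0 < 3 * (e%:R - 3) * l ^+ 2 - (16 * e%:R - 18) * l - 4 * e%:R * (e%:R - 3) ->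
  c * (l * (l + 1)) < l + e%:R.
Proof.
move=> k3 e5 ek l0 hl hend.
have D30 : 0 <= D3 by apply: sumr_ge0.
have D32 : D3 <= D2.
  apply: ler_sum => v Sv; case h: (adj p3 v) => //.
  by rewrite (nest3 Sv h).
have D21 : D2 <= D1.
  apply: ler_sum => v Sv; case h: (adj p2 v) => //.
  by rewrite (nest2 Sv h).
have W0 : 0 <= W by apply: sumr_ge0 => v _; apply: sumr_ge0.
have b0 : 0 <= b := ltW (x0 p2).
apply: (@third_bound _ l e%:R k%:R D3 (D3 + W) (D1 + D2) (a + b) c) => //.
- exact: addr_ge0.
- by have := W_le; lra.
- by lra.
- by have := W_edges; lra.
- have := ler_wpM2r b0 D21; have := top_a; have := top_b; lra.
- by have := top_c; lra.
Qed.

End Triangle.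
End Top.

(** Here p1, p2 and p3 are chosen as successive maxima of x off o.  Of the two
    ends of an edge avoiding o and p1, at most one is p2, so the other has value
    at most x p3; this is why the third largest value is the one to bound. *)
Lemma one_hub : 3 <= k%:R :> R -> 5 <= e%:R :> R ->
  2 * e%:R <= (k%:R + 2) * (k%:R - 1) :> R ->
  0 < l -> l * (k%:R + 1) < e%:R * (l - k%:R) ->
  0 < 3 * (e%:R - 3) * l ^+ 2 - (16 * e%:R - 18) * l - 4 * e%:R * (e%:R - 3) ->
  e%:R < l ^+ 2 ->
  (n%:R - 2 - e%:R) * (l ^+ 2 - e%:R) + l * ((e%:R + 1) * l + 2 * e%:R)
    <= l ^+ 2 * (l ^+ 2 - e%:R) ->
  (2 <= #|G|)%N ->
  exists p1 : G, p1 != o /\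
    forall u v, u != o -> u != p1 -> v != o -> v != p1 -> ~~ adj u v.
Proof.
move=> k3 e5 ek l0 hl hend el hn G2.
have [v0 v0o] : exists v0 : G, v0 != o.
  apply/existsP; apply: contraLR G2; rewrite negb_exists -ltnNge => /forallP h.
  rewrite (@eq_card _ _ (pred1 o)) ?card1 // => v; rewrite !inE.
  by have := h v; rewrite negbK => ->.
have [p1 [p1o p1max]] := exists_max (P := fun v => v != o) x v0o.
exists p1; split=> // i j io i1 jo j1; apply/negP => ij.
pose S v := (v != o) && (v != p1).
have Si : S i by rewrite /S io.
have Sj : S j by rewrite /S jo.
have [p2 [Sp2 p2max]] := exists_max x Si.
have [p2o p21] := andP Sp2.
have nij : i != j by apply: contraTneq ij => ->; rewrite adj_irr.
(* If p2 is not an end of the edge i j, nestedness moves the end j to p2. *)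
have [h [Sh hp2 p2h]] : exists h, [/\ S h, h != p2 & adj p2 h].
  have [ip2|ip2] := eqVneq i p2.
    by exists j; rewrite -ip2 eq_sym.
  exists i; split=> //; have [<-|jp2] := eqVneq j p2; first by rewrite adj_sym.
  apply: (nest (v := j)) => //; [by rewrite eq_sym | by rewrite adj_sym | exact: p2max].
have Sh' : S h && (h != p2) by rewrite Sh.
have [p3 [Sp3 p3max]] := exists_max (P := fun v => S v && (v != p2)) x Sh'.
have [Sp3' p32] := andP Sp3; have [p3o p31] := andP Sp3'.
have [ho h1] := andP Sh.
have a23 : adj p2 p3.
  have [<-//|hp3] := eqVneq h p3; rewrite adj_sym.
  apply: (nest (v := h)) => //; [by rewrite eq_sym | by rewrite eq_sym | | exact: p3max].
  by rewrite adj_sym.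
have a12 : adj p1 p2 := dom1 p1o p1max Sp2 Sp3' a23.
have a13 : adj p1 p3 by apply: (dom1 p1o p1max Sp3' Sp2); rewrite adj_sym.
have c_lt := third_le p1o p1max Sp2 p2max Sp3 p3max a12 a13 a23 k3 e5 ek l0 hl hend.
have pair_le u v : S u -> S v -> adj u v -> x u + x v <= x p1 + x p3.
  move=> Su Sv uv; have [up2|up2] := eqVneq u p2.
    have vp2 : v != p2 by apply: contraTneq uv => ->; rewrite up2 adj_irr.
    by apply: lerD; [apply: p1max; case/andP: Su | apply: p3max; rewrite Sv].
  rewrite addrC.
  by apply: lerD; [apply: p1max; case/andP: Sv | apply: p3max; rewrite Su].
pose p := \sum_(v | S v) A p1 v.
pose W2 := \sum_(v | S v) \sum_(u | S u) A v u.
have W2pos : 0 < W2.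
  rewrite /W2 (bigD1 i) //= (bigD1 j) //= ij ltr_wpDr ?ltr_wpDr ?ltr01 //.
    by apply: sumr_ge0 => v _; apply: sumr_ge0.
  by apply: sumr_ge0.
have := @center_contradiction _ l e%:R n%:R p (W2 / 2) (x p1) (x p3) _ _ l0 el
  _ _ (eq_o p1o) (eq_sumS p1o) (eq_sumN p1o p1max) (Z_le pair_le) hn.
rewrite leNgt c_lt /= => h'; have : false; last by [].
apply: h'; first by rewrite divr_gt0.
by have := eq_edges p1o; rewrite -/p -/W2; lra.
Qed.

End DominatedMaximizer.

(** * The maximizer is V *)

(** The leaves of the star in V correspond to the neighbours of p other than o,
    the vertices of degree one to those adjacent to o only. *)
Lemma two_hubs_iso (n e : nat) (G : sgraph) (o p : G) :
  classC n e G -> p != o -> (forall v, v != o -> adj o v) ->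
  (forall u v, u != o -> u != p -> v != o -> v != p -> ~~ adj u v) ->
  (e + 2 <= n)%N ->
  #|[set v | [&& v != o, v != p & adj p v]]| = e -> isomorphic G (graphV n e).
Proof.
move=> [_ Gn _] po dom none en; set A := [set v | _] => cA.
pose B := [set v | [&& v != o, v != p & ~~ adj p v]].
have cB : #|B| = (n - e - 2)%N.
  have : #|A :|: B| = #|~: [set o; p]|.
    apply: eq_card => v; rewrite !inE -!andb_orr orbN andbT.
    by rewrite negb_or.
  have AB : A :&: B = set0.
    by apply/setP => v; rewrite !inE; case: (adj p v); rewrite ?andbF.
  have := cardsC [set o; p]; rewrite cards2 eq_sym po Gn cardsU AB cards0 cA.
  by lia.
pose g (v : graphV n e) : G := match v with
  | inl (inl (inl _)) => p
  | inl (inl (inr i)) => enum_val (cast_ord (esym cA) i)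
  | inl (inr j) => enum_val (cast_ord (esym cB) j)
  | inr _ => o end.
have gA i : [&& g (inl (inl (inr i))) != o, g (inl (inl (inr i))) != p
    & adj p (g (inl (inl (inr i))))].
  by have := enum_valP (cast_ord (esym cA) i); rewrite inE.
have gB j : [&& g (inl (inr j)) != o, g (inl (inr j)) != p
    & ~~ adj p (g (inl (inr j)))].
  by have := enum_valP (cast_ord (esym cB) j); rewrite inE.
have gE a b : adj (g a) (g b) = adj a b.
  have no := fun u v h1 h2 h3 h4 => negPf (none u v h1 h2 h3 h4).
  case: a b => [[[i|i]|i]|i] [[[j|j]|j]|j]; rewrite /= ?adj_irr //.
  - by case/and3P: (gA j).
  - by case/and3P: (gB j) => _ _ /negPf.
  - by rewrite adj_sym dom.
  - by rewrite adj_sym; case/and3P: (gA i).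
  - by case/and3P: (gA i) => ? ? _; case/and3P: (gA j) => ? ? _; apply: no.
  - by case/and3P: (gA i) => ? ? _; case/and3P: (gB j) => ? ? _; apply: no.
  - by rewrite adj_sym dom //; case/and3P: (gA i).
  - by rewrite adj_sym; case/and3P: (gB i) => _ _ /negPf.
  - by case/and3P: (gB i) => ? ? _; case/and3P: (gA j) => ? ? _; apply: no.
  - by case/and3P: (gB i) => ? ? _; case/and3P: (gB j) => ? ? _; apply: no.
  - by rewrite adj_sym dom //; case/and3P: (gB i).
  - by rewrite dom.
  - by rewrite dom //; case/and3P: (gA j).
  - by rewrite dom //; case/and3P: (gB j).
have ginj : injective g.
  case=> [[[i|i]|i]|i] [[[j|j]|j]|j] gab.
  - by rewrite (ord1 i) (ord1 j).
  - by have := gA j; rewrite -gab /= eqxx andbF.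
  - by have := gB j; rewrite -gab /= eqxx andbF.
  - by have := po; rewrite [p]gab eqxx.
  - by have := gA i; rewrite gab /= eqxx andbF.
  - by move/enum_val_inj/cast_ord_inj: gab => ->.
  - by have := gA i; rewrite gab; case/and3P: (gB j) => _ _ /negPf->; rewrite !andbF.
  - by have := gA i; rewrite gab /= eqxx.
  - by have := gB i; rewrite gab /= eqxx andbF.
  - by have := gA j; rewrite -gab; case/and3P: (gB i) => _ _ /negPf->; rewrite !andbF.
  - by move/enum_val_inj/cast_ord_inj: gab => ->.
  - by have := gB i; rewrite gab /= eqxx.
  - by have := po; rewrite -[p]gab eqxx.
  - by have := gA j; rewrite -gab /= eqxx.
  - by have := gB j; rewrite -gab /= eqxx.
  - by rewrite (ord1 i) (ord1 j).
apply: iso_sym; exists g; split=> //; apply: inj_card_bij ginj _.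
by have [_ -> _] := classC_V en; rewrite Gn.
Qed.

(** The condition t_e >= 1 excludes e = C(k, 2); together with e >= 5
    and the choice of k this gives all the bounds, free of binomial coefficients. *)
Lemma k_bounds (e : nat) : (5 <= e)%N -> (1 <= t_ e)%N ->
  [/\ (3 <= k_ e)%N, (k_ e * (k_ e - 1) + 2 <= 2 * e)%N,
      (2 * e + 2 <= k_ e * (k_ e + 1))%N & (k_ e + 1 < e)%N].
Proof.
move=> e5 t1; have [ke kmax] := k_P e; rewrite /t_ subn_gt0 in t1.
have bin2E k : ('C(k, 2) * 2 = k * (k - 1))%N.
  by have := bin_ffact k 2; rewrite ffactnS ffactn1 subn1.
have k3 : (3 <= k_ e)%N.
  by apply: kmax; apply: leq_trans e5.
have kS : (e < 'C((k_ e).+1, 2))%N.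
  by rewrite ltnNge; apply/negP => /kmax; rewrite ltnn.
have := bin2E (k_ e); have := bin2E (k_ e).+1; move: k3 t1 kS.
set k := k_ e; move: k => k {ke kmax}; set x := 'C(k, 2); set y := 'C(k.+1, 2).
move: x y => x y k3 xe ey yE xE; split=> //; [lia | nia |].
by case: (leqP k 3) => k3'; [lia | nia].
Qed.

(** The bound on the radius of V passes to that of G, which is at least as large. *)
Lemma maximizer_iso (R : realType) (e k n : nat) (G : sgraph) :
  (5 <= e)%N -> (3 <= k)%N -> (k * (k - 1) + 2 <= 2 * e)%N ->
  (2 * e + 2 <= k * (k + 1))%N -> (k + 1 < e)%N -> (e + 2 <= n)%N ->
  0 < spectral_radius R (graphV n e) ->
  spectral_radius R (graphV n e) * (k%:R + 1) <
    e%:R * (spectral_radius R (graphV n e) - k%:R) ->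
  max_spectral_radius R n e G -> isomorphic G (graphV n e).
Proof.
move=> e5 k3 ek ek' ke' en; set r := spectral_radius R (graphV n e) => r0 hr Gmax.
have [GC Gbest] := Gmax; have [[G0 _] Gn _] := GC.
have le_r : r <= spectral_radius R G := Gbest _ (classC_V en).
have [o [x [x0 xE xo dom nest]]] := maximizer_dominated Gmax.
set l := spectral_radius R G in le_r xE.
have k3R : 3 <= k%:R :> R by rewrite (ler_nat R 3).
have e5R : 5 <= e%:R :> R by rewrite (ler_nat R 5).
have ekR : 2 * e%:R <= (k%:R + 2) * (k%:R - 1) :> R.
  by move: ek'; rewrite -(ler_nat R) natrD !natrM natrD; lra.
have ke : k%:R + 1 < e%:R :> R by rewrite natr1 ltr_nat -addn1.
have l0 : 0 < l := lt_le_trans r0 le_r.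
have hl : l * (k%:R + 1) < e%:R * (l - k%:R).
  have : 0 <= (l - r) * (e%:R - (k%:R + 1)) by rewrite mulr_ge0 // subr_ge0 // ltW.
  by lra.
have hend := far_end_gt0 k3 ek ek' l0 hl.
have [_ lk2 el2] := ell_lower k3R (ler0n _ e) ekR l0 (ltW hl).
have el : e%:R < l ^+ 2 by lra.
have hn : (n%:R - 2 - e%:R) * (l ^+ 2 - e%:R)
    + l * ((e%:R + 1) * l + 2 * e%:R) <= l ^+ 2 * (l ^+ 2 - e%:R).
  rewrite leNgt; apply/negP => /(lt_spectral_radius_V en l0 el).
  by rewrite ltNge le_r.
have G2 : (2 <= #|G|)%N by rewrite Gn (leq_trans _ en) // leq_addl.
have [p [po none]] := one_hub GC x0 xE xo dom nest k3R e5R ekR l0 hl hend el hn G2.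
apply: (two_hubs_iso GC po dom none en).
have := eq_edges R GC dom po.
rewrite [X in _ + X]big1 ?addr0 => [|u /andP[uo up]]; last first.
  by apply: big1 => v /andP[vo vp]; rewrite (negPf (none _ _ uo up vo vp)).
move=> e2; have /eqP : e%:R = \sum_(v | (v != o) && (v != p)) (adj p v)%:R :> R.
  by apply: (mulfI _ e2); rewrite pnatr_eq0.
rewrite -natr_sum eqr_nat => /eqP ->.
rewrite -sum1_card big_mkcond [RHS]big_mkcond; apply: eq_bigr => v _.
by rewrite inE; case: (v != o) (v != p) (adj p v) => [] [] [].
Qed.

Theorem theorem5p1 (R : realType) (e n : nat)
  (he : (5 <= e)%N) (ht : (1 <= t_ e)%N)
  (hn : (n%:R : rat) > e%:R + 2 +
          ell_ e * (ell_ e + 1) * (ell_ e ^+ 2 - ell_ e - 2 * e%:R)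
            / (ell_ e ^+ 2 - e%:R)) :
  max_spectral_radius R n e (graphV n e) /\
  (forall G : sgraph, max_spectral_radius R n e G -> isomorphic G (graphV n e)).
Proof.
have [k3 ek ek' ke] := k_bounds he ht; set k := k_ e in k3 ek ek' ke.
pose L : R := e%:R * k%:R / (e%:R - k%:R - 1).
have LE : ratr (ell_ e) = L.
  by rewrite /ell_ -/k fmorph_div rmorphM !rmorphB /= !rmorph_nat rmorph1.
have hnR : e%:R + 2 + L * (L + 1) * (L ^+ 2 - L - 2 * e%:R) / (L ^+ 2 - e%:R) < n%:R.
  move: hn LE; move: (ell_ e) => q hn LE; move: hn; rewrite -(ltr_rat R) rmorph_nat !rmorphD /= fmorph_div !rmorphM.
  by rewrite !rmorphB !rmorphD /= !rmorphXn !rmorphM !rmorph_nat rmorph1 /= LE.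
have k3R : 3 <= k%:R :> R by rewrite (ler_nat R 3).
have ekR : 2 * e%:R <= (k%:R + 2) * (k%:R - 1) :> R.
  by move: ek'; rewrite -(ler_nat R) natrD !natrM natrD; lra.
have keR : k%:R + 1 < e%:R :> R by rewrite natr1 ltr_nat -addn1.
have q0 : 0 < e%:R - k%:R - 1 :> R by lra.
have L0 : 0 < L by rewrite divr_gt0 ?mulr_gt0 //; lra.
have Lq : L * (e%:R - k%:R - 1) = e%:R * k%:R by rewrite divfK // gt_eqF.
have LkL : L * (k%:R + 1) <= e%:R * (L - k%:R) by lra.
have [_ Lk2 eL2] := ell_lower k3R (ler0n _ e) ekR L0 LkL.
have eL : e%:R < L ^+ 2 by lra.
rewrite -subr_ge0 in eL2.
have d0 : 0 < L ^+ 2 - e%:R by lra.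
have en : (e + 2 <= n)%N.
  rewrite -(ler_nat R) natrD; apply/ltW/(le_lt_trans _ hnR).
  rewrite lerDl; apply: divr_ge0; last exact: ltW.
  apply: mulr_ge0 => //; apply: mulr_ge0; first exact: ltW.
  by rewrite addr_ge0 // ltW.
(* Clearing the denominator turns the bound on n into the test inequality
   for V at L. *)
have Lr : L < spectral_radius R (graphV n e).
  apply: lt_spectral_radius_V => //.
  have : L * (L + 1) * (L ^+ 2 - L - 2 * e%:R) / (L ^+ 2 - e%:R) < n%:R - 2 - e%:R by lra.
  by rewrite ltr_pdivrMr //; lra.
have iso G : max_spectral_radius R n e G -> isomorphic G (graphV n e).
  apply: (maximizer_iso he k3 ek ek' ke en); first exact: lt_trans Lr.
  have : L * (e%:R - k%:R - 1) < spectral_radius R (graphV n e) * (e%:R - k%:R - 1).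
    by rewrite ltr_pM2r.
  by rewrite Lq; lra.
split=> //; have [M Mmax] := maximizer_exists R (classC_V en).
split=> [|H HC]; first exact: classC_V.
have [[[M0 _] _ _] Mbest] := Mmax.
exact: le_trans (Mbest H HC) (iso_spectral_radius_le R M0 (iso M Mmax)).
Qed.
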